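(* Let $M$ be a separable metric space. If for every ordinal $\alpha<\omega_1$ the metric space $\mathbb Z[\mathcal S_\alpha]_{c_0}$ coarsely embeds into $M$, then every separable metric space coarsely embeds into $M$.
   Context: A metric space ''contains a coarse copy of $X$'' if $X$ coarsely embeds into it. A map $\phi\colon X\to E$ between metric spaces is a coarse embedding if there are non-decreasing functions $\kappa,\omega\colon[0,\infty)\to[0,\infty)$ with $\lim_{t\to\infty}\kappa(t)=\infty$ and $\kappa(d_X(x,y))\leqslant d_E(\phi(x),\phi(y))\leqslant\omega(d_X(x,y))$ for all $x,y\in X$. Schreier families. Let $\mathbb N=\{1,2,3,\ldots\}$. For finite $A,B\subseteq\mathbb N$ and $n\in\mathbb N$, write $n\leqslant A$ if $A=\emptyset$ or $n\leqslant\min A$, and $A<B$ if $A=\emptyset$ or $B=\emptyset$ or $\max A<\min B$. For every countable limit ordinal $\lambda$ fix once and for all an increasing sequence of ordinals $\lambda_1<\lambda_2<\cdots$ with limit $\lambda$. Define families $\mathcal S_\alpha$ ($\alpha<\omega_1$) of finite subsets of $\mathbb N$ by recursion: - $\mathcal S_0=\{\{n\}: n\in\mathbb N\}\cup\{\emptyset\}$; - $\mathcal S_{\alpha+1}$ is the set of all unions $\bigcup_{j=1}^nA_j$ where $n\in\mathbb N$, $A_1,\ldots,A_n\in\mathcal S_\alpha$, $n\leqslant A_j$ for all $j$, and $A_i<A_j$ for all $i<j$; - for $\lambda$ a limit ordinal, $\mathcal S_\lambda=\{A:\ \exists n\in\mathbb N\ \ A\in\mathcal S_{\lambda_n}\text{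 and }n\leqslant A\}$. Let $(e_n)_{n=1}^\infty$ be the standard unit vector basis of the real Banach space $c_0$. Then $\mathbb Z[\mathcal S_\alpha]_{c_0}$ is the set $\{\sum_{i\in A}t_ie_i:\ A\in\mathcal S_\alpha,\ t_i\in\mathbb Z\}\subseteq c_0$ with the metric induced by the norm of $c_0$. *)

(* Defs.v *)
From HB Require Import structures.
From mathcomp Require Import all_boot all_order all_algebra finmap.
From mathcomp Require Import wochoice.
From mathcomp Require Import all_classical all_reals all_analysis.

Set Implicit Arguments.
Unset Strict Implicit.
Unset Printing Implicit Defensive.

Import Order.TTheory GRing.Theory Num.Theory.
Import numFieldNormedType.Exports.

Local Open Scope classical_set_scope.
Local Open Scope ring_scope.

(* omega1 is carved out of a well-ordering of the uncountable type
   nat -> bool: it consists of the x having only countably many predecessors.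
   By omega1_well_order, omega1_countable_segment and omega1_uncountable its
   elements are the ordinals alpha < omega_1, up to the unique isomorphism. *)
Definition cantor_wo : rel (nat -> bool) :=
  sval (well_ordering_principle (nat -> bool)).

Lemma cantor_woP : well_order cantor_wo.
Proof. exact: svalP (well_ordering_principle _). Qed.

Lemma cantor_wo_total : total cantor_wo.
Proof.
move=> x y.
have [|z [[/orP[]/eqP-> lb] _]] := @cantor_woP [predU1 x & pred1 y].
- by exists x; rewrite inE eqxx.
- by rewrite lb// !inE eqxx orbT.
- by rewrite [X in _ || X]lb ?orbT// inE eqxx.
Qed.

Lemma cantor_wo_anti : antisymmetric cantor_wo.
Proof.
have refl x : cantor_wo x x by have := cantor_wo_total x x; rewrite orbb.
move=> x y /andP[xy yx].
have [|z [_ zU]] := @cantor_woP [predU1 x & pred1 y].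
  by exists x; rewrite inE eqxx.
rewrite -(zU x) ?(zU y)//; split; rewrite ?inE ?eqxx ?orbT//.
- by move=> w; rewrite !inE => /orP[]/eqP->.
- by move=> w; rewrite !inE => /orP[]/eqP->.
Qed.

Lemma cantor_wo_trans : transitive cantor_wo.
Proof.
have refl x : cantor_wo x x by have := cantor_wo_total x x; rewrite orbb.
move=> y x z xy yz.
have [|m [[]]] :=
    @cantor_woP [pred w | (w == x) || (w == y) || (w == z)].
  by exists x; rewrite !inE eqxx.
rewrite !inE => /orP[/orP[]|] /eqP-> lb _.
- by apply: lb; rewrite !inE eqxx !orbT.
- suff -> : x = y by [].
  by apply: cantor_wo_anti; rewrite xy lb// !inE eqxx.
- have -> : z = y.
    by apply: cantor_wo_anti; rewrite yz lb// !inE eqxx orbT.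
  suff -> : x = y by [].
  by apply: cantor_wo_anti; rewrite xy (@cantor_wo_anti y z) ?yz ?lb// !inE
    eqxx ?orbT.
Qed.

Definition omega1_set : set (nat -> bool) :=
  [set x | countable [set y | cantor_wo y x]].

Definition omega1 : Type := set_type omega1_set.

HB.instance Definition _ := SubChoice.on omega1.

Definition omega1_le (a b : omega1) : bool := cantor_wo (\val a) (\val b).
Definition omega1_lt (a b : omega1) : bool := (b != a) && omega1_le a b.

Lemma omega1_le_anti : antisymmetric omega1_le.
Proof. by move=> a b /cantor_wo_anti/val_inj. Qed.

HB.instance Definition _ := @Order.isOrder.Build (Order.Disp tt tt) omega1
  omega1_le omega1_lt _ _ (fun _ _ => erefl) (fun _ _ => erefl)
  (fun _ _ => erefl) omega1_le_anti (fun a b c => @cantor_wo_trans _ _ _)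
  (fun _ _ => cantor_wo_total _ _).

Lemma omega1_well_order : well_order (<=%O : rel omega1).
Proof.
apply: antisymmetric_well_order => [|A [a Aa]]; first exact: le_anti.
pose B : {pred nat -> bool} :=
  fun x => `[< exists2 b : omega1, b \in A & \val b = x >].
have [|z [[/asboolP[b Ab <-] lb] _]] := @cantor_woP B.
  by exists (\val a); apply/asboolP; exists a.
by exists b; split=> // c Ac; apply: lb; apply/asboolP; exists c.
Qed.

Lemma omega1_countable_segment (a : omega1) : countable [set b | (b < a)%O].
Proof.
have ca : countable [set y | cantor_wo y (\val a)] by exact: (set_mem (valP a)).
have /countable_injP[f fI] := ca.
apply/countable_injP; exists (f \o \val) => b c.
rewrite !inE => /ltW ba /ltW ca' /fI bc; apply/val_inj/bc.
- exact: mem_set.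
- exact: mem_set.
Qed.

Lemma cantor_uncountable : ~ countable [set: nat -> bool].
Proof.
move=> /pfcard_geP[/seteqP[/(_ (fun=> true) I)]//|[f]].
have [n _ fn] := @surj _ _ _ _ f (fun n => ~~ f n n) I.
by have := congr1 (@^~ n) fn => /= /esym; case: (f n n).
Qed.

Lemma omega1_uncountable : ~ countable [set: omega1].
Proof.
move=> c1.
have cO : countable omega1_set.
  apply: sub_countable c1; rewrite -(card_le_eql (card_setT _)).
  exact: card_lexx.
have [|m [[Om lb] _]] := @cantor_woP [pred x | x \notin omega1_set].
  apply: contrapT => nO; apply: cantor_uncountable.
  apply: sub_countable cO; apply: subset_card_le => x _.
  apply: contrapT => Ox; apply: nO; exists x; rewrite inE.
  by apply: contra_notN Ox => /set_mem.
move: Om; rewrite inE => /negP; apply; apply/mem_set.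
have lbO y : cantor_wo y m -> y != m -> y \in omega1_set.
  move=> ym yNm; apply: contraNT yNm => Oy.
  by apply/eqP/cantor_wo_anti; rewrite ym lb.
have /countable_injP[f fI] := cO.
apply/countable_injP; exists (fun y => if y == m then 0%N else (f y).+1).
move=> y z; rewrite !inE => ym zm.
case: ifPn => [/eqP->|yNm]; case: ifPn => [/eqP->//|zNm]//= [].
exact: fI (lbO _ ym yNm) (lbO _ zm zNm).
Qed.

Definition is_zero (a : omega1) : Prop := forall b : omega1, ~~ (b < a)%O.

Definition is_succ (a b : omega1) : Prop :=
  (a < b)%O /\ forall c : omega1, (c < b)%O -> (c <= a)%O.

Definition is_limit (l : omega1) : Prop :=
  ~ is_zero l /\ forall a, ~ is_succ a l.

(* A simultaneous choice, for every countable limit ordinal l, of a sequence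
   lam l 1 < lam l 2 < ... with limit l; the values lam l 0, and lam a n for a
   not a limit, play no role. *)
Definition fundamental_sequences (lam : omega1 -> nat -> omega1) : Prop :=
  forall l, is_limit l ->
    [/\ forall m n, (0 < m < n)%N -> (lam l m < lam l n)%O,
        forall n, (0 < n)%N -> (lam l n < l)%O
      & forall b, (b < l)%O -> exists2 n, (0 < n)%N & (b < lam l n)%O].

(* Finite subsets of {1, 2, 3, ...} are finite sets of positive elements of
   nat; all the members of the Schreier families below are such sets. *)
Definition nat_le_fset (n : nat) (A : {fset nat}) : Prop :=
  forall a, a \in A -> (n <= a)%N.

Definition fset_lt (A B : {fset nat}) : Prop :=
  forall a b, a \in A -> b \in B -> (a < b)%N.

(* Every ordinal is exactly one of: zero, a successor, a limit; the recursion
   equations are schreier0E, schreierSE and schreierLE. *)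
Inductive schreier (lam : omega1 -> nat -> omega1) :
    omega1 -> {fset nat} -> Prop :=
| schreier_zero_empty a : is_zero a -> schreier lam a fset0
| schreier_zero_single a n : is_zero a -> (0 < n)%N ->
    schreier lam a [fset n]%fset
| schreier_succ a b n (A : nat -> {fset nat}) : is_succ a b -> (0 < n)%N ->
    (forall j, (1 <= j <= n)%N -> schreier lam a (A j)) ->
    (forall j, (1 <= j <= n)%N -> nat_le_fset n (A j)) ->
    (forall i j, (1 <= i < j)%N -> (j <= n)%N -> fset_lt (A i) (A j)) ->
    schreier lam b (\bigcup_(j <- iota 1 n) A j)%fset
| schreier_limit l n A : is_limit l -> (0 < n)%N ->
    schreier lam (lam l n) A -> nat_le_fset n A -> schreier lam l A.

Lemma is_succ_inj a a' b : is_succ a b -> is_succ a' b -> a = a'.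
Proof. by move=> [ab mb] [ab' mb']; apply/le_anti; rewrite mb' ?mb. Qed.

Lemma zero_succF a b : is_zero b -> is_succ a b -> False.
Proof. by move=> b0 [ab _]; move: (b0 a); rewrite ab. Qed.

Lemma ordinal_cases a : is_zero a \/ (exists b, is_succ b a) \/ is_limit a.
Proof.
have [|a0] := pselect (is_zero a); first by left.
have [|aS] := pselect (exists b, is_succ b a); first by right; left.
by right; right; split=> // b ba; apply: aS; exists b.
Qed.

Lemma schreier0E lam a : is_zero a ->
  schreier lam a =
    [set A | A = fset0 \/ exists2 n, (0 < n)%N & A = [fset n]%fset].
Proof.
move=> a0; apply/seteqP; split=> A /=.
  move=> SA; case: SA a0 => {a A}; [by left|by right; exists n| |].
    by move=> a b n A ab _ _ _ _ b0; case: (zero_succF b0 ab).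
  by move=> l n A [].
move=> [->|[n n0 ->]]; [exact: schreier_zero_empty|].
exact: schreier_zero_single.
Qed.

Lemma schreierSE lam a b : is_succ a b ->
  schreier lam b = [set B | exists n (A : nat -> {fset nat}),
    [/\ (0 < n)%N,
        forall j, (1 <= j <= n)%N -> schreier lam a (A j),
        forall j, (1 <= j <= n)%N -> nat_le_fset n (A j),
        forall i j, (1 <= i < j)%N -> (j <= n)%N -> fset_lt (A i) (A j)
      & B = (\bigcup_(j <- iota 1 n) A j)%fset]].
Proof.
move=> ab; apply/seteqP; split=> B /=; last first.
  by move=> [n [A [n0 SA nA ltA ->]]]; apply: schreier_succ ab n0 SA nA ltA.
move=> SB; case: SB ab => {b B}.
- by move=> b b0 /(zero_succF b0).
- by move=> b n b0 _ /(zero_succF b0).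
- move=> a' b n A ab' n0 SA nA ltA ab; rewrite (is_succ_inj ab ab').
  by exists n, A.
- by move=> l n A [_ /(_ a)].
Qed.

Lemma schreierLE lam l : is_limit l ->
  schreier lam l = [set A | exists2 n, (0 < n)%N &
    schreier lam (lam l n) A /\ nat_le_fset n A].
Proof.
move=> ll; apply/seteqP; split=> A /=; last first.
  by move=> [n n0 [SA nA]]; apply: schreier_limit ll n0 SA nA.
move=> SA; case: SA ll => {l A}.
- by move=> a a0 [].
- by move=> a n a0 _ [].
- by move=> a b n A ab _ _ _ _ [_ /(_ a)].
- by move=> l n A _ n0 SA nA _; exists n.
Qed.

Section SequenceSpace.
Variable R : realType.

Definition c0_pred : {pred nat -> R} := fun u => `[< u @ \oo --> (0 : R) >].

Record c0 := C0 { c0_val :> nat -> R; _ : c0_val \in c0_pred }.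

HB.instance Definition _ := [isSub for c0_val].
HB.instance Definition _ := [Choice of c0 by <:].

Lemma c0_submod_closed : submod_closed c0_pred.
Proof.
split; first by apply/asboolP; exact: cvg_cst.
move=> a u v /asboolP u0 /asboolP v0; apply/asboolP.
by have := cvgD (cvgZl_tmp (k := a) u0) v0; rewrite scaler0 addr0; exact.
Qed.

HB.instance Definition _ := GRing.isSubmodClosed.Build R (nat -> R) c0_pred
  c0_submod_closed.
HB.instance Definition _ := [SubChoice_isSubLmodule of c0 by <:].

Definition c0_norm (u : c0) : R := sup (range (fun n => `|u n|)).

Lemma c0_has_sup (u : c0) : has_sup (range (fun n => `|u n|)).
Proof.
split; first by exists `|u 0%N|; exists 0%N.
case: u => u /= /asboolP u0.
have /cvg_seq_bounded/bounded_fun_has_ubound : cvgn (fun n => `|u n|).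
  by apply/cvg_ex; exists `|0 : R|; exact: cvg_norm.
by [].
Qed.

Lemma c0_norm_ub (u : c0) n : `|u n| <= c0_norm u.
Proof. by apply: sup_upper_bound; [exact: c0_has_sup|exists n]. Qed.

Lemma c0_norm_le (u : c0) x : (forall n, `|u n| <= x) -> c0_norm u <= x.
Proof.
move=> ux; apply: sup_le_ub => [|_ [n _ <-]//].
by have [] := c0_has_sup u.
Qed.

Lemma c0_ler_normD (u v : c0) : c0_norm (u + v) <= c0_norm u + c0_norm v.
Proof.
apply: c0_norm_le => n; apply: (le_trans (ler_normD (u n) (v n))).
by apply: lerD; exact: c0_norm_ub.
Qed.

Lemma c0_normZ (a : R) (u : c0) : c0_norm (a *: u) = `|a| * c0_norm u.
Proof.
have le b w : c0_norm (b *: w) <= `|b| * c0_norm w.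
  apply: c0_norm_le => n; rewrite [X in `|X|](_ : _ = b * w n)// normrM.
  by rewrite ler_wpM2l// c0_norm_ub.
have [->|a0] := eqVneq a 0.
  rewrite scale0r normr0 mul0r; apply/eqP; rewrite eq_le; apply/andP; split.
    by apply: c0_norm_le => n; rewrite normr0.
  by apply: le_trans (c0_norm_ub _ 0).
apply/eqP; rewrite eq_le le/= -ler_pdivlMl ?normr_gt0//.
by rewrite -normfV -[X in c0_norm X <= _](scalerK a0) le.
Qed.

Lemma c0_norm_eq0 (u : c0) : c0_norm u = 0 -> u = 0.
Proof.
move=> u0; apply/val_inj/funext => n; apply/normr0_eq0/eqP.
by rewrite eq_le normr_ge0 -u0 c0_norm_ub.
Qed.

HB.instance Definition _ := Lmodule_isNormed.Build R c0
  c0_ler_normD c0_normZ c0_norm_eq0.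

Definition c0_dist (u v : c0) : R := `|u - v|.

Lemma c0_dist_ge0 u v : 0 <= c0_dist u v.
Proof. exact: normr_ge0. Qed.

Lemma c0_dist_eq0 u v : c0_dist u v = 0 -> u = v.
Proof. by move=> /normr0_eq0/eqP; rewrite subr_eq0 => /eqP. Qed.

Lemma c0_ballE (u : c0) (r : R) : ball u r = [set v | c0_dist u v < r].
Proof. by rewrite -ball_normE. Qed.

HB.instance Definition _ := PseudoMetric_isMetric.Build R c0
  c0_dist_ge0 c0_dist_eq0 c0_ballE.

(* e_1, e_2, ... is the standard basis: e_n has its 1 at index n - 1. *)
Definition c0_basis_fun (n : nat) : nat -> R := fun k => (k.+1 == n)%:R.

Lemma c0_basis_proof n : c0_basis_fun n \in c0_pred.
Proof.
apply/asboolP; apply: cvg_near_cst.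
exists n => // k /= nk; rewrite /c0_basis_fun; case: eqP => // kn.
by move: nk; rewrite -kn ltnn.
Qed.

Definition c0_basis (n : nat) : c0 := C0 (c0_basis_proof n).

End SequenceSpace.

Section SubsetMetric.
Variables (R : realType) (X : metricType R) (A : set X).

Definition subset_dist (x y : A) : R := mdist (\val x) (\val y).

Lemma subset_dist_ge0 x y : 0 <= subset_dist x y.
Proof. exact: mdist_ge0. Qed.

Lemma subset_dist_eq0 x y : subset_dist x y = 0 -> x = y.
Proof. by move=> /mdist_positivity/val_inj. Qed.

Lemma subset_ballE (x : A) (r : R) : ball x r = [set y | subset_dist x y < r].
Proof.
apply/seteqP; split=> y; rewrite /ball/= /initial_ball ballEmdist//.
Qed.

HB.instance Definition _ := PseudoMetric_isMetric.Build R (set_type A)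
  subset_dist_ge0 subset_dist_eq0 subset_ballE.

End SubsetMetric.

Definition Z_schreier_set (R : realType) (lam : omega1 -> nat -> omega1)
    (a : omega1) : set (c0 R) :=
  [set x | exists2 A : {fset nat}, schreier lam a A &
     exists t : nat -> int, x = \sum_(i <- A) (t i)%:~R *: c0_basis R i].
Arguments Z_schreier_set : clear implicits.

Definition Z_schreier (R : realType) (lam : omega1 -> nat -> omega1)
  (a : omega1) : metricType R := set_type (Z_schreier_set R lam a).
Arguments Z_schreier : clear implicits.

Definition coarse_embedding (R : realType) (X E : metricType R)
    (phi : X -> E) : Prop :=
  exists kappa omega : R -> R,
    [/\ forall t : R, 0 <= t -> 0 <= kappa t /\ 0 <= omega t,
        forall s t : R, 0 <= s <= t ->
          kappa s <= kappa t /\ omega s <= omega t,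
        kappa t @[t --> +oo] --> +oo
      & forall x y, kappa (mdist x y) <= mdist (phi x) (phi y) <=
          omega (mdist x y)].

Definition coarsely_embeds (R : realType) (X E : metricType R) : Prop :=
  exists phi : X -> E, coarse_embedding phi.

Definition separable_space (X : topologicalType) : Prop :=
  exists2 D : set X, countable D & dense D.

(* Main.v *)
(* Finitely supported functions nat -> nat (the "grid") are enumerated as
   grid 0, grid 1, ..., and partial coarse embeddings of the grid into a
   countable dense subset of M, together with finitely many values of their
   control functions, form a countable tree. A coarse embedding of Z[S_a] yields
   a child-preserving map from S_a, ordered by end-extension, into this tree:
   a set A with k elements carries a copy of the grid points supported on the
   first k coordinates. As S_a has rank at least a, the tree cannot have a
   countable rank, so it has an infinite branch, which is a coarse embedding of
   the grid into M.

   The grid is coarsely universal for separable metric spaces by a coarse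
   version of Aharoni's argument: for a dense sequence (q_i), the functions
   min (3k - d(x, q_i), min_(j < i) (d(x, q_j) - k)), i >= 1, k >= 1, are
   1-Lipschitz, finitely many of them have a positive value at a given x, and
   those of scale k separate points at distance at least 5k. *)
Require Import Defs.
From HB Require Import structures.
From mathcomp Require Import all_boot all_order all_algebra finmap.
From mathcomp Require Import all_classical all_reals all_analysis.
From mathcomp Require Import zify lra.

Set Implicit Arguments.
Unset Strict Implicit.
Unset Printing Implicit Defensive.

Import Order.TTheory GRing.Theory Num.Theory.
Import numFieldNormedType.Exports.

Local Open Scope classical_set_scope.
Local Open Scope ring_scope.

(** * Induction on countable ordinals and ranked trees *)

Lemma omega1_ind (P : omega1 -> Prop) :
  (forall a, (forall b, (b < a)%O -> P b) -> P a) -> forall a, P a.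
Proof.
move=> IH a; apply: contrapT => nPa.
have [|m [[Pm lb] _]] := @omega1_well_order [pred x | ~~ `[< P x >]].
  by exists a; rewrite inE; apply/asboolP.
move: Pm; rewrite inE => /asboolP; apply; apply: IH => b bm.
apply: contrapT => nPb; have := lb b; rewrite inE.
by move=> /(_ (introN (asboolP _) nPb)); rewrite leNgt bm.
Qed.

(** Otherwise countably many countable initial segments would cover [omega1]. *)
Lemma omega1_countable_bound (T : countType) (B : T -> omega1) :
  exists a, forall c, (B c < a)%O.
Proof.
apply: contrapT => nB; apply: omega1_uncountable.
have cU : countable (\bigcup_(c in [set: T]) ([set b | (b < B c)%O] `|` [set B c])).
  apply: bigcup_countable => // c _.
  rewrite -bigcup2E; apply: bigcup_countable => // -[|[|n]] _ //=.
  exact: omega1_countable_segment.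
apply: sub_countable cU; apply: subset_card_le => a _.
apply: contrapT => na; apply: nB; exists a => c; rewrite ltNge le_eqVlt.
by apply/negP => /orP[/eqP aB|aB]; apply: na; exists c => //; [right|left].
Qed.

(** The ordinal is an upper bound for the rank of [s], not the rank itself; a node at which an
    infinite branch starts has none. *)
Inductive ranked (T : Type) (child : T -> T -> Prop) : T -> omega1 -> Prop :=
| Ranked s a (B : T -> omega1) : (forall c, child s c -> (B c < a)%O) ->
    (forall c, child s c -> ranked child c (B c)) -> ranked child s a.

(** If all children of a node are ranked, countability of [T] gives one strict bound for them, which
    ranks the node. So an unranked node has an unranked child, and this iterates. *)
Lemma unranked_branch (T : countType) (child : T -> T -> Prop) (root : T) :
  (forall a, ~ ranked child root a) ->
  exists s : nat -> T, s 0 = root /\ forall k, child (s k) (s k.+1).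
Proof.
move=> root_unranked; pose U s := forall a, ~ ranked child s a.
have next s : exists c, U s -> child s c /\ U c.
  apply: contrapT => nc.
  have Us : U s by apply: contrapT => nUs; apply: nc; exists s => /nUs.
  (* The empty family yields some ordinal, to be used at points that are not children of [s]. *)
  have [a0 _] := omega1_countable_bound (fun v : void => match v with end).
  have /choice[B rB] c : exists b, child s c -> ranked child c b.
    apply: contrapT => nb; apply: nc; exists c => _; split.
      by apply: contrapT => nsc; apply: nb; exists a0 => /nsc.
    by move=> b rb; apply: nb; exists b.
  have [a Ba] := omega1_countable_bound B.
  by apply: (Us a); apply: (Ranked (B := B)).
have {next}[f fU] := choice next.
have Uf k : U (iter k f root).
  by elim: k => //= k /fU[].
exists (fun k => iter k f root); split=> // k.
by have [] := fU _ (Uf k).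
Qed.

(** * Rank of the Schreier families *)

Lemma schreier0 lam a : fundamental_sequences lam -> schreier lam a fset0.
Proof.
move=> hlam; elim/omega1_ind: a => a IH.
have [a0|[[b [ba ab]]|al]] := ordinal_cases a.
- exact: schreier_zero_empty.
- rewrite (_ : fset0 = \bigcup_(j <- iota 1 1) fset0)%fset; last first.
    by rewrite big_seq1.
  by apply: (@schreier_succ _ b) => // *; exact: IH.
- have [_ la _] := hlam _ al.
  by apply: (@schreier_limit _ _ 1) => //; exact/IH/la.
Qed.

Lemma schreier1 lam a n : fundamental_sequences lam -> (0 < n)%N ->
  schreier lam a [fset n]%fset.
Proof.
move=> hlam n0; elim/omega1_ind: a => a IH.
have n1 : nat_le_fset 1 [fset n]%fset by move=> x; rewrite in_fset1 => /eqP->.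
have [a0|[[b [ba ab]]|al]] := ordinal_cases a.
- exact: schreier_zero_single.
- rewrite (_ : [fset n] = \bigcup_(j <- iota 1 1) [fset n])%fset; last first.
    by rewrite big_seq1.
  apply: (@schreier_succ _ b) => // *; first exact: IH.
  by lia.
- have [_ la _] := hlam _ al.
  by apply: (@schreier_limit _ _ 1) => //; exact/IH/la.
Qed.

Lemma schreier_succ_cons lam a b n A : fundamental_sequences lam ->
  is_succ a b -> (1 < n)%N -> schreier lam a A -> nat_le_fset n.+1 A ->
  schreier lam b (n |` A)%fset.
Proof.
move=> hlam ab n1 SA nA.
rewrite (_ : _ |` _ =
  \bigcup_(j <- iota 1 2) (if j == 1 then [fset n] else A))%fset; last first.
  by rewrite /= big_cons big_seq1.
apply: (@schreier_succ _ a) => // [j _|j _|i j i0 j2].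
- by case: eqP => // _; apply: schreier1 => //; lia.
- case: eqP => // _ x; first by rewrite in_fset1 => /eqP->.
  by move=> /nA; lia.
- have [-> ->] : i = 1%N /\ j = 2%N by lia.
  by move=> x y /=; rewrite in_fset1 => /eqP-> /nA.
Qed.

Lemma schreier_pos lam a A x : schreier lam a A -> x \in A -> (0 < x)%N.
Proof.
move=> SA; elim: SA x => {a A} [a a0 x|a n a0 n0 x|a b n A ab n0 _ IH _ _ x|//].
- by rewrite in_fset0.
- by rewrite in_fset1 => /eqP->.
- move=> /bigfcupP[j]; rewrite mem_iota andbT => /andP[j0 jn].
  by apply: IH; lia.
Qed.

(* The cut-off [m] is there for the induction: below a successor, [h] is replaced
   by [fun A => h (n |` A)], which only makes sense for [A] above [n]. *)
Lemma schreier_rank lam (T : Type) (child : T -> T -> Prop) a m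
    (h : {fset nat} -> T) r : fundamental_sequences lam ->
  (forall A n, schreier lam a A -> schreier lam a (n |` A)%fset ->
     nat_le_fset m (n |` A)%fset -> (forall i, i \in A -> (i < n)%N) ->
     child (h A) (h (n |` A)%fset)) ->
  ranked child (h fset0) r -> (a <= r)%O.
Proof.
move=> hlam; elim/omega1_ind: a m h r => a IH m h r hh rk.
have [a0|[[b ba]|al]] := ordinal_cases a.
- by rewrite leNgt a0.
(* At least [m] for the cut-off, and at least 2 so that two pieces, [[fset n]] and a later set, may
   be joined. *)
- pose n := maxn m 2.
  have hn : child (h fset0) (h [fset n]%fset).
    rewrite -[in X in child _ X](fsetU0 [fset n]%fset); apply: hh => //.
    + exact: schreier0.
    + by rewrite fsetU0; apply: schreier1 => //; lia.
    + by rewrite fsetU0 => x; rewrite in_fset1 => /eqP->; lia.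
  move E : (h fset0) rk hn => s rk; case: rk E => {}s {}r B Br rB _ hn.
  suff bB : (b <= B (h [fset n]%fset))%O.
    rewrite leNgt; apply/negP => /ba.2; rewrite leNgt => /negP; apply.
    exact: le_lt_trans bB (Br _ hn).
  apply: (IH b ba.1 n.+1 (fun A => h (n |` A)%fset)); last first.
    by rewrite fsetU0; exact: rB.
  move=> A k SA SkA nA Ak; rewrite fsetUCA; apply: hh.
  + apply: (schreier_succ_cons hlam ba) SA _; first by lia.
    by move=> x xA; apply: nA; rewrite in_fsetU xA orbT.
  + by rewrite fsetUCA; apply: (schreier_succ_cons hlam ba) => //; lia.
  + rewrite fsetUCA => x; rewrite in_fsetU in_fset1 => /orP[/eqP->|/nA]; lia.
  + have := nA k; rewrite in_fsetU in_fset1 eqxx => /(_ isT) nk.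
    by move=> x; rewrite in_fsetU in_fset1 => /orP[/eqP->|/Ak].
- have [_ la supl] := hlam _ al.
  rewrite leNgt; apply/negP => /supl[k k0]; apply/negP; rewrite -leNgt.
  (* Above the cut-off [k], members of the family of [lam l k] belong to that of [l]. *)
  apply: (IH _ (la _ k0) (maxn m k) h r _ rk) => A n SA SnA mA An.
  apply: hh => // [||x /mA]; [| |lia].
  + apply: schreier_limit al k0 SA _ => x xA.
    by have := mA x; rewrite in_fsetU xA orbT => /(_ isT); lia.
  + by apply: schreier_limit al k0 SnA _ => x /mA; lia.
Qed.

(** If the root had a rank [r], an index [a] above [r] would contradict [schreier_rank]. *)
Theorem schreier_branch lam (T : countType) (child : T -> T -> Prop) (root : T) :
  fundamental_sequences lam ->
  (forall a, exists h : {fset nat} -> T, h fset0 = root /\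
     forall A n, schreier lam a A -> schreier lam a (n |` A)%fset ->
       (forall i, i \in A -> (i < n)%N) -> child (h A) (h (n |` A)%fset)) ->
  exists s : nat -> T, s 0 = root /\ forall k, child (s k) (s k.+1).
Proof.
move=> hlam emb; apply: unranked_branch => r rk.
have [a ra] := omega1_countable_bound (fun _ : unit => r).
have [h [h0 hh]] := emb a.
have : (a <= r)%O.
  apply: (@schreier_rank lam T child a 0 h) => //; last by rewrite h0.
  by move=> A n *; exact: hh.
by rewrite leNgt ra.
Qed.

(** * Dense sequences and the grid *)

Lemma separable_dense_seq (R : realType) (X : metricType R) (x0 : X) :
  separable_space X ->
  exists q : nat -> X, forall x (e : R), 0 < e -> exists n, mdist x (q n) < e.
Proof.
move=> [D cD dD].
have ball0 (x : X) (e : R) : 0 < e -> exists2 y, D y & mdist x y < e.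
  move=> e0; have [|y [By Dy]] := dD (interior (ball x e)) _ (@open_interior _ _).
    by exists x; exact: nbhsx_ballx.
  by exists y => //; have := interior_subset By; rewrite ballEmdist.
have /pfcard_geP[D0|[f]] := cD.
  by have [y] := ball0 x0 1 ltr01; rewrite D0.
exists f => x e /(ball0 x)[y Dy xy].
by have [n _ fn] := @surj _ _ _ _ f _ Dy; exists n; rewrite fn.
Qed.

Lemma inj_nat_unbounded (f : nat -> nat) (N : nat) : injective f ->
  exists j, (N <= f j)%N.
Proof.
move=> fI; apply: contrapT => nf.
have /uniq_leq_size : uniq (map f (iota 0 N.+1)) by rewrite map_inj_uniq ?iota_uniq.
move=> /(_ (iota 0 N)); rewrite size_map !size_iota ltnn => h.
suff: false by []. apply: h => _ /mapP[j _ ->]; rewrite mem_iota /= ltnNge.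
by apply/negP => ?; apply: nf; exists j.
Qed.

(* Every finitely supported function occurs infinitely often, thanks to the unused
   second component of the code; this makes truncating the m-th one to its first m
   coordinates harmless. *)
Definition grid (m : nat) : nat -> nat :=
  if (choice.unpickle m : option (seq nat * nat)) is Some (s, _)
  then nth 0 (take m s) else fun=> 0.

Lemma grid_out m c : (m <= c)%N -> grid m c = 0.
Proof.
rewrite /grid; case: choice.unpickle => [[s _]|] // mc.
by rewrite nth_default // size_take_min; lia.
Qed.

Lemma grid_surj (u : nat -> nat) N : (forall c, (N <= c)%N -> u c = 0) ->
  exists m, grid m =1 u.
Proof.
move=> uN; have [|j Nj] := @inj_nat_unbounded (fun j => choice.pickle (mkseq u N, j)) N.
  by move=> i j /(pcan_inj choice.pickleK)[].
exists (choice.pickle (mkseq u N, j)) => c.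
rewrite /grid choice.pickleK take_oversize ?size_mkseq//.
have [cN|Nc] := ltnP c N; first by rewrite nth_mkseq.
by rewrite nth_default ?size_mkseq // uN.
Qed.

Definition near_by (l : nat) (u v : nat -> nat) : Prop :=
  forall c, (u c <= v c + l)%N /\ (v c <= u c + l)%N.

(** One-sided, so that for [0 < t] the coordinate [c] lies in the support of [u]. *)
Definition far_by (t : nat) (u v : nat -> nat) : Prop :=
  exists c, (v c + t <= u c)%N.

(** * Copies of grid points in the Schreier spaces *)

Section Spread.
Variable R : realType.
Implicit Types (A : {fset nat}) (u v : nat -> nat).

Local Notation srt A := (sort leq (enum_fset A)).

(** Sorting keeps the coordinate of each element of [A] fixed when larger elements are added. *)
Definition spread A u : c0 R :=
  \sum_(i <- A) ((u (index i (srt A)))%:Z)%:~R *: c0_basis R i.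

Lemma spread_Z_schreier lam a A u : schreier lam a A ->
  Z_schreier_set R lam a (spread A u).
Proof. by move=> SA; exists A => //; exists (fun i => (u (index i (srt A)))%:Z). Qed.

Lemma spreadE A u p :
  spread A u p = if p.+1 \in A then (u (index p.+1 (srt A)))%:R else 0.
Proof.
have valD : {morph (fun x : c0 R => x p) : x y / x + y} by [].
have -> : spread A u p =
   \sum_(i <- A) ((u (index i (srt A)))%:R * (p.+1 == i)%:R).
  by rewrite /spread (big_morph (fun x : c0 R => x p) valD (erefl : (0 : c0 R) p = 0)).
case: ifPn => [pA|pA].
  rewrite (big_rem _ pA) /= eqxx mulr1 big_seq big1 ?addr0 // => i.
  rewrite rem_filter ?fset_uniq // mem_filter /= => /andP[ip _].
  by rewrite eq_sym (negPf ip) mulr0.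
rewrite big_seq big1 // => i iA; case: eqP => [pi|_]; last by rewrite mulr0.
by move: pA; rewrite pi iA.
Qed.

Lemma spread_near A u v l : near_by l u v -> mdist (spread A u) (spread A v) <= l%:R.
Proof.
move=> uv; apply: c0_norm_le => p.
rewrite [X in `|X|](_ : _ = spread A u p - spread A v p)//.
rewrite !spreadE; case: ifP => _; last by rewrite subrr normr0.
set c := index _ _; have [h1 h2] := uv c.
move: h1 h2; rewrite -!(ler_nat R) !natrD => h1 h2.
by rewrite ler_norml; apply/andP; split; lra.
Qed.

Lemma spread_far A u v t : (0 < t)%N -> (forall x, x \in A -> (0 < x)%N) ->
  (forall c, (#|` A| <= c)%N -> u c = 0) -> far_by t u v ->
  t%:R <= mdist (spread A u) (spread A v).
Proof.
move=> t0 A0 u0 [c vu].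
have cA : (c < size (srt A))%N.
  by rewrite size_sort ltnNge; apply/negP => /u0; lia.
have xA : nth 0 (srt A) c \in A by rewrite -(mem_sort leq) mem_nth.
set x := nth _ _ _ in xA; have x0 := A0 _ xA.
(* The basis vector of [x] has its 1 at index [x - 1], so [x] must be positive. *)
apply: le_trans (c0_norm_ub _ x.-1).
rewrite [X in `|X|](_ : _ = spread A u x.-1 - spread A v x.-1)//.
rewrite !spreadE prednK // xA /x index_uniq ?sort_uniq ?fset_uniq //.
apply: le_trans (ler_norm _).
by rewrite lerBrDr -natrD ler_nat addnC.
Qed.

Lemma sort_fsetU1 A n : (forall i, i \in A -> (i < n)%N) ->
  srt (n |` A)%fset = rcons (srt A) n.
Proof.
move=> An; apply: (@sorted_eq _ leq leq_trans anti_leq).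
  exact: (sort_sorted leq_total).
  case E : (srt A) => [//|a s] /=; rewrite rcons_path.
  have := sort_sorted leq_total (enum_fset A); rewrite E /= => -> /=.
  by apply/ltnW/An; rewrite -(mem_sort leq) E mem_last.
have nA : n \notin A by apply/negP => /An; rewrite ltnn.
apply: uniq_perm; rewrite ?sort_uniq ?fset_uniq //.
  by rewrite rcons_uniq mem_sort nA sort_uniq fset_uniq.
by move=> x; rewrite mem_rcons inE !mem_sort in_fsetU in_fset1.
Qed.

(** The new element takes the last coordinate, where [u] vanishes. This makes the nodes attached to
    [A] and to its end-extension agree. *)
Lemma spread_fsetU1 A n u : (forall i, i \in A -> (i < n)%N) ->
  u #|` A| = 0 -> spread (n |` A)%fset u = spread A u.
Proof.
move=> An u0; apply/val_inj/funext => p; rewrite /= !spreadE.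
rewrite in_fsetU in_fset1 sort_fsetU1 //.
have [->|pn] /= := eqVneq p.+1 n.
  have nA : n \notin A by apply/negP => /An; rewrite ltnn.
  rewrite -cats1 index_cat mem_sort (negPf nA) /= eqxx addn0 size_sort.
  by rewrite u0.
case: ifP => // pA; congr ((u _)%:R).
by rewrite -cats1 index_cat mem_sort pA.
Qed.

End Spread.

(** * The tree of partial embeddings *)

Section PartialEmbeddings.
Variables (R : realType) (M : metricType R) (q : nat -> M).

(* Entry i of a partial embedding is a triple (t_i, w_i, v_i): the grid point of
   index i is sent to q v_i, grid points t_i apart have images i apart, and
   grid points within i of each other have images within w_i. *)
Definition partial_embedding (s : seq (nat * nat * nat)) : Prop :=
  forall i j l, (i < size s)%N -> (j < size s)%N -> (l < size s)%N ->
    let: nd := nth (0, 0, 0)%N s in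
    (near_by l (grid i) (grid j) -> mdist (q (nd i).2) (q (nd j).2) <= (nd l).1.2%:R) /\
    (far_by (nd l).1.1 (grid i) (grid j) -> l%:R <= mdist (q (nd i).2) (q (nd j).2)).

Definition extends_by_one (s s' : seq (nat * nat * nat)) : Prop :=
  (exists x, s' = rcons s x) /\ partial_embedding s'.

(** The nodes are prefixes of one infinite sequence, and the condition on [i], [j], [l] is read off
    a node longer than all three. *)
Lemma branch_embedding (s : nat -> seq (nat * nat * nat)) :
  s 0 = [::] -> (forall k, extends_by_one (s k) (s k.+1)) ->
  exists (t w : nat -> nat) (f : nat -> M), forall i j l,
    (near_by l (grid i) (grid j) -> mdist (f i) (f j) <= (w l)%:R) /\
    (far_by (t l) (grid i) (grid j) -> l%:R <= mdist (f i) (f j)).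
Proof.
move=> s0 sS; pose d := (0, 0, 0)%N.
have szs k : size (s k) = k.
  by elim: k => [|k IH]; rewrite ?s0//; have [[x ->] _] := sS k; rewrite size_rcons IH.
have nths i k : (i < k)%N -> nth d (s k) i = nth d (s i.+1) i.
  elim: k => // k IH; rewrite ltnS leq_eqVlt => /orP[/eqP->//|ik].
  by have [[x ->] _] := sS k; rewrite nth_rcons szs ik IH.
pose nd i := nth d (s i.+1) i.
exists (fun i => (nd i).1.1), (fun i => (nd i).1.2), (fun i => q (nd i).2) => i j l.
pose K := (i + j + l)%N.
have [_] := sS K => /(_ i j l); rewrite !szs !(@nths _ K.+1); try lia.
by apply; lia.
Qed.

(** The node of [A] sends the first [#|A|] grid points to their copies over [A], then through [phi],
    then to a point of [q] within 1. *)
Lemma schreier_partial_embeddings lam a :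
  (forall x (e : R), 0 < e -> exists n, mdist x (q n) < e) ->
  coarsely_embeds (Z_schreier R lam a) M ->
  exists h : {fset nat} -> seq (nat * nat * nat), h fset0 = [::] /\
     forall A n, schreier lam a A -> schreier lam a (n |` A)%fset ->
       (forall i, i \in A -> (i < n)%N) ->
       extends_by_one (h A) (h (n |` A)%fset).
Proof.
move=> qD [phi [kappa [omega [kw0 kwM koo kphi]]]].
(* Indexing [V] by vectors of [c0] makes the approximant independent of the set [A] and of
   membership proofs. *)
have /choice[V phiV] x : exists n : nat, forall z : Z_schreier R lam a,
    \val z = x -> mdist (phi z) (q n) < 1.
  have [[z zx]|nz] := pselect (exists z : Z_schreier R lam a, \val z = x).
    have [n qn] := qD (phi z) 1 ltr01; exists n => z' z'x.
    by rewrite (_ : z' = z) //; apply/val_inj; rewrite z'x.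
  by exists 0 => z zx; case: nz; exists z.
(* The 2 here and in [w] pays for replacing both images by points of [q]. *)
have /choice[t tP] l : exists t : nat, (0 < t)%N /\
    forall s, t%:R <= s -> (l + 2)%:R <= kappa s.
  move/cvgryPge : koo => /(_ (l + 2)%:R)[B [_ BP]].
  exists (Num.truncn B).+1; split => // s ts; apply: BP.
  exact: lt_le_trans (truncnS_gt _) ts.
pose w l := (Num.truncn (omega l%:R + 2)).+1.
pose node A i := (t i, w i, V (spread R A (grid i))).
exists (fun A => mkseq (node A) #|` A|); split => [|A n SA SnA An].
  by rewrite cardfs0.
have nA : n \notin A by apply/negP => /An; rewrite ltnn.
have szn : #|` (n |` A)%fset| = #|` A|.+1 by rewrite cardfsU1 nA.
rewrite szn; split.
  exists (node (n |` A)%fset #|` A|); rewrite /mkseq -addn1 iotaD map_cat cats1 /=.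
  congr (rcons _ _); apply/eq_in_map => i; rewrite mem_iota add0n => /andP[_ iA].
  by rewrite /node spread_fsetU1 // grid_out // ltnW.
move=> i j l; rewrite size_mkseq => iA jA lA; rewrite !nth_mkseq //=.
set B := (n |` A)%fset.
have B0 x : x \in B -> (0 < x)%N by exact: schreier_pos SnA.
pose z m : Z_schreier R lam a := SigSub (mem_set (spread_Z_schreier R (grid m) SnA)).
have zi := phiV _ (z i) erefl; have zj := phiV _ (z j) erefl.
have := kphi (z i) (z j); set D := mdist (z i) (z j).
have {}zi : mdist (phi (z i)) (q (V (spread R B (grid i)))) < 1 := zi.
have {}zj : mdist (phi (z j)) (q (V (spread R B (grid j)))) < 1 := zj.
move: zi zj; set qi := q _; set qj := q _ => zi zj /andP[kD Dw].
split=> [/(spread_near R B) nij|fij].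
- have : omega D <= omega l%:R by apply: (kwM D l%:R _).2; rewrite mdist_ge0.
  have := truncnS_gt (omega l%:R + 2); rewrite -/(w l).
  have := metric_triangle qi (phi (z i)) qj.
  have := metric_triangle (phi (z i)) (phi (z j)) qj.
  by rewrite (metric_sym qi (phi (z i))); lra.
- have [tl tk] := tP l.
  have : (t l)%:R <= D.
    apply: spread_far => // c; rewrite szn => Bc; apply: grid_out; lia.
  move=> /tk; rewrite natrD.
  have := metric_triangle (phi (z i)) qi (phi (z j)).
  have := metric_triangle qi qj (phi (z j)).
  by rewrite (metric_sym qj (phi (z j))); lra.
Qed.

End PartialEmbeddings.

Lemma grid_embedding (R : realType) lam (M : metricType R) (m0 : M) :
  fundamental_sequences lam -> separable_space M ->
  (forall a : omega1, coarsely_embeds (Z_schreier R lam a) M) ->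
  exists (t w : nat -> nat) (f : nat -> M), forall i j l,
    (near_by l (grid i) (grid j) -> mdist (f i) (f j) <= (w l)%:R) /\
    (far_by (t l) (grid i) (grid j) -> l%:R <= mdist (f i) (f j)).
Proof.
move=> hlam /(separable_dense_seq m0)[q qD] hZ.
have [|s [s0 sS]] := schreier_branch (child := extends_by_one q) (root := [::]) hlam.
  by move=> a; exact: schreier_partial_embeddings.
exact: branch_embedding s0 sS.
Qed.

(** * Control functions from integer data *)

Lemma coarse_embedding_controls (R : realType) (X E : metricType R)
    (phi : X -> E) (t w : nat -> nat) :
  (forall l x y, mdist x y <= l%:R -> mdist (phi x) (phi y) <= (w l)%:R) ->
  (forall l x y, (t l)%:R <= mdist x y -> l%:R <= mdist (phi x) (phi y)) ->
  coarse_embedding phi.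
Proof.
move=> wP tP.
(* The summand [l] keeps the admissible [l] below [n.+1], and [K n >= l] as soon as
   [n >= l + t l]. *)
pose K n := (\max_(l < n.+1 | l + t l <= n) l)%N.
(* A sum is monotone even if [w] is not; it reaches [w n.+1] because a distance with integer part
   [n] is only bounded by [n.+1]. *)
pose W n := (\sum_(0 <= j < n.+2) w j)%N.
have KM m n : (m <= n)%N -> (K m <= K n)%N.
  move=> mn; apply/bigmax_leqP => i im.
  have iN : (i < n.+1)%N by lia.
  apply: (@leq_bigmax_cond _ (fun l : 'I_n.+1 => l + t l <= n)%N
    (fun l => l : nat) (Ordinal iN)) => /=.
  by lia.
have WM m n : (m <= n)%N -> (W m <= W n)%N.
  by move=> mn; rewrite /W (@big_cat_nat _ _ _ m.+2 0 n.+2) //= leq_addr.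
exists (fun s => (K (Num.truncn s))%:R), (fun s => (W (Num.truncn s))%:R); split.
- by move=> s _; rewrite !ler0n.
- by move=> s s' /andP[_ /le_truncn ss]; rewrite !ler_nat; split; [exact: KM|exact: WM].
- apply/cvgryPge => A; set l := (Num.truncn A).+1; exists (l + t l)%:R; split => // s ls.
  apply: (@le_trans _ _ l%:R); first exact/ltW/truncnS_gt.
  have ls' : (l + t l <= Num.truncn s)%N.
    by rewrite truncn_ge_nat ?ltW // (le_lt_trans _ ls).
  rewrite ler_nat; have lN : (l < (Num.truncn s).+1)%N by lia.
  exact: (@leq_bigmax_cond _ (fun i : 'I_(Num.truncn s).+1 => i + t i <= Num.truncn s)%N
    (fun i => i : nat) (Ordinal lN)).
- move=> x y; apply/andP; split.
    rewrite /K; elim/big_ind: _ => [|m n|i il]; first by rewrite mdist_ge0.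
      by rewrite /maxn; case: ifP.
    apply: tP; rewrite -truncn_ge_nat ?mdist_ge0 //; lia.
  apply: le_trans (wP (Num.truncn (mdist x y)).+1 _ _ (ltW (truncnS_gt _))) _.
  by rewrite ler_nat /W big_nat_recr //= leq_addl.
Qed.

(** * A coarse Aharoni map into the grid *)

Section GridMap.
Variables (R : realType) (X : metricType R) (q : nat -> X).

Definition bump (k i : nat) (x : X) : R :=
  \big[Num.min/(3 * k)%:R - mdist x (q i)]_(j < i) (mdist x (q j) - k%:R).

Lemma bump_lipschitz k i x y : bump k i x <= bump k i y + mdist x y.
Proof.
rewrite -lerBlDr; apply: le_bigmin => [|j _].
  have := bigmin_le_id (index_enum 'I_i) ((3 * k)%:R - mdist x (q i)) xpredT
    (fun j => mdist x (q j) - k%:R).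
  have := metric_triangle y x (q i); rewrite (metric_sym y x) -/(bump k i x); lra.
have := bigmin_le ((3 * k)%:R - mdist x (q i)) j (fun j : 'I_i => mdist x (q j) - k%:R).
have := metric_triangle x y (q j); rewrite -/(bump k i x); lra.
Qed.

Lemma bump_le0_far k i x : (3 * k)%:R <= mdist x (q i) -> bump k i x <= 0.
Proof.
by move=> kx; apply: le_trans (bigmin_le_id _ _ _ _) _; rewrite subr_le0.
Qed.

Lemma bump_le0_near k i j x : (j < i)%N -> mdist x (q j) <= k%:R -> bump k i x <= 0.
Proof.
move=> ji xk; apply: le_trans (bigmin_le _ (Ordinal ji) _) _.
by rewrite subr_le0.
Qed.

Hypothesis qD : forall x (e : R), 0 < e -> exists n, mdist x (q n) < e.

Lemma bump_large k x : (0 < k)%N ->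
  exists i, mdist x (q i) < (2 * k)%:R /\ k%:R <= bump k i x.
Proof.
move=> k0; have : exists n, mdist x (q n) < (2 * k)%:R.
  by apply: qD; rewrite ltr0n; lia.
(* take the first [i] with [x] within [2 * k] of [q i] *)
move=> exq; case: (ex_minnP exq) => i xi imin; exists i; split => //.
(* The term of [q i] exceeds [3k - 2k], and those of earlier points are at least [2k - k]. *)
apply: le_bigmin => [|j _].
  by rewrite lerBrDr; move: xi; rewrite !natrM; lra.
rewrite leNgt; apply/negP => xj.
suff /imin : mdist x (q j) < (2 * k)%:R by rewrite leqNgt ltn_ord.
by move: xj; rewrite natrM; lra.
Qed.

(* Index 0 is left out: the bumps at scale k then vanish within k of [q 0]. *)
Definition coords (x : X) (c : nat) : nat :=
  if (choice.pickle_inv c : option (nat * nat)) is Some (k, i)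
  then Num.truncn (bump k.+1 i.+1 x) else 0.

Lemma coords_near l x y : mdist x y <= l%:R -> near_by l (coords x) (coords y).
Proof.
have le_coords x' y' c : mdist x' y' <= l%:R -> (coords x' c <= coords y' c + l)%N.
  move=> xyl; rewrite /coords; case: choice.pickle_inv => [[k i]|] //.
  rewrite truncn_le_nat -addSn natrD.
  have := truncnS_gt (bump k.+1 i.+1 y'); have := bump_lipschitz k.+1 i.+1 x' y'.
  lra.
by move=> xyl c; split; apply: le_coords; rewrite // metric_sym.
Qed.

(** A point within 2 scales of [q i] sees a large bump there, while the other point is at least 3
    scales from [q i] and sees none. The omitted index 0 cannot serve both points, as they would be
    less than 4 scales apart. *)
Lemma coords_far k x y : (5 * k.+1)%:R <= mdist x y ->
  far_by k.+1 (coords x) (coords y) \/ far_by k.+1 (coords y) (coords x).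
Proof.
have far x' y' i : (5 * k.+1)%:R <= mdist x' y' -> mdist x' (q i.+1) < (2 * k.+1)%:R ->
    k.+1%:R <= bump k.+1 i.+1 x' -> far_by k.+1 (coords x') (coords y').
  move=> xy xi bx; exists (choice.pickle (k, i)); rewrite /coords choice.pickleK_inv.
  have by0 : bump k.+1 i.+1 y' <= 0.
    apply: bump_le0_far; have := metric_triangle x' (q i.+1) y'.
    by rewrite (metric_sym (q i.+1)); move: xy xi; rewrite !natrM; lra.
  have -> : Num.truncn (bump k.+1 i.+1 y') = 0.
    by apply/eqP; rewrite -leqn0 truncn_le_nat (le_lt_trans by0).
  by rewrite add0n truncn_ge_nat // (le_trans _ bx).
move=> xy; have [[|i] [xi bx]] := bump_large x (ltn0Sn k); last first.
  by left; exact: far xy xi bx.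
have [[|j] [yj by_]] := bump_large y (ltn0Sn k).
  have := metric_triangle x (q 0) y; rewrite (metric_sym (q 0)).
  have : (0 : R) < k.+1%:R by rewrite ltr0n.
  by move: xy xi yj; rewrite !natrM; lra.
by right; apply: far yj by_; rewrite metric_sym.
Qed.

(** Scales beyond the distance to [q 0] vanish because of [q 0]; indices beyond a [J] with [q J]
    within 1 of [x] vanish because of [q J]. Finitely many codes remain. *)
Lemma coords_finite x : exists N, forall c, (N <= c)%N -> coords x c = 0.
Proof.
have [J xJ] := qD x ltr01.
pose K := (Num.truncn (mdist x (q 0))).+1.
exists (\max_(k < K) \max_(i < J) choice.pickle (k : nat, i : nat)).+1 => c Nc.
rewrite /coords; case E : choice.pickle_inv => [[k i]|] //.
have bump0 : bump k.+1 i.+1 x <= 0 -> Num.truncn (bump k.+1 i.+1 x) = 0.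
  by move=> b0; apply/eqP; rewrite -leqn0 truncn_le_nat (le_lt_trans b0).
have [Kk|kK] := leqP K k.
  apply/bump0/(bump_le0_near (j := 0)) => //; apply/ltW/(lt_le_trans (truncnS_gt _)).
  by rewrite ler_nat; exact: leqW.
have [Ji|iJ] := leqP J i.
  apply/bump0/(bump_le0_near (j := J)) => //; apply/ltW/(lt_le_trans xJ).
  by rewrite ler1n.
have {E} E : choice.pickle (k, i) = c.
  by have := @choice.pickle_invK (nat * nat)%type c; rewrite E.
move: Nc; rewrite -E ltnNge => /negP[].
apply: leq_trans (@leq_bigmax_cond _ xpredT (fun k : 'I_K =>
  \max_(i < J) choice.pickle (k : nat, i : nat))%N (Ordinal kK) isT).
exact: (@leq_bigmax_cond _ xpredT (fun i : 'I_J => choice.pickle (k, i : nat))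
  (Ordinal iJ) isT).
Qed.

End GridMap.

(** * Passage through the grid to an arbitrary separable space *)

Lemma coarse_embedding_grid (R : realType) (X M : metricType R) (x0 : X)
    (t w : nat -> nat) (f : nat -> M) : separable_space X ->
  (forall i j l,
    (near_by l (grid i) (grid j) -> mdist (f i) (f j) <= (w l)%:R) /\
    (far_by (t l) (grid i) (grid j) -> l%:R <= mdist (f i) (f j))) ->
  coarsely_embeds X M.
Proof.
move=> /(separable_dense_seq x0)[q qD] fP.
have /choice[F FE] x : exists m, grid m =1 coords q x.
  by have [N xN] := coords_finite qD x; exact: grid_surj xN.
have {}FE x : grid (F x) = coords q x by exact/funext/FE.
exists (f \o F).
(* [coords_far] at [k = t l] separates at scale [(t l).+1], slightly more than needed. *)
apply: (coarse_embedding_controls (t := fun l => (5 * (t l).+1)%N) (w := w)).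
  by move=> l x y xyl; apply: (fP _ _ l).1; rewrite !FE; exact: coords_near.
have weaken l u v : far_by (t l).+1 u v -> far_by (t l) u v.
  by move=> [c uv]; exists c; lia.
move=> l x y /(coords_far qD); rewrite -!FE => -[] /weaken/(fP _ _ l).2 //.
by rewrite metric_sym.
Qed.

Theorem mainTheorem1 (R : realType) (lam : omega1 -> nat -> omega1)
    (hlam : fundamental_sequences lam)
    (M : metricType R) (hM : separable_space M)
    (hZ : forall a : omega1, coarsely_embeds (Z_schreier R lam a) M) :
  forall X : metricType R, separable_space X -> coarsely_embeds X M.
Proof.
move=> X hX.
(* [M] is inhabited by the image of the copy of a grid point over the empty set. *)
have m0 : M.
  have [a _] := cid (omega1_countable_bound (fun v : void => match v with end)).
  have [phi _] := cid (hZ a); apply: phi.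
  exact: (SigSub (mem_set (spread_Z_schreier R (grid 0) (schreier0 a hlam)))).
have [t [w [f fP]]] := grid_embedding m0 hlam hM hZ.
have [[x0 _]|X0] := pselect (exists x : X, True).
  exact: coarse_embedding_grid x0 t w f hX fP.
exists (fun=> m0); apply: (coarse_embedding_controls (t := id) (w := id)) => l x.
  by case: X0; exists x.
by case: X0; exists x.
Qed.
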